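(* Let $X$ be a Banach space with norm $\|\cdot\|_X$. Let $(T_k(t))_{t\ge0}$, $k=1,\dots,m$, be strongly continuous semigroups on $X$ with generators $(A_k,D(A_k))$ respectively. Assume that $A=A_1+\cdots+A_m$ with domain $D(A)=\bigcap_{k=1}^mD(A_k)$ is closable and that its closure is the generator of a strongly continuous semigroup $(T(t))_{t\ge0}$ on $X$. Let $(F_k(t))_{t\ge0}$, $k=1,\dots,m$, be families of operators on $X$ which are Chernoff equivalent to the semigroups $(T_k(t))_{t\ge0}$ respectively, i.e. for each $k\in\{1,\dots,m\}$ the map $t\mapsto F_k(t)$ is strongly continuous, $F_k(0)=\mathrm{Id}$, $\|F_k(t)\|\le e^{a_kt}$ for some $a_k>0$ and all $t\ge 0$, and there is a set $D_k\subset D(A_k)$, which is a core for $A_k$, such that $\lim_{t\to0}\left\|\frac{F_k(t)\varphi-\varphi}{t}-A_k\varphi\right\|_X=0$ for each $\varphi\in D_k$. Assume that there exists a set $D\subset\bigcap_{k=1}^mD_k$ which is a core for $A$. Then the family $(F(t))_{t\ge0}$, where $F(t)=F_1(t)\circ\cdots\circ F_m(t)$, is Chernoff equivalent to the semigroup $(T(t))_{t\ge0}$ and, hence, the Feynman formula $$T(t)=\lim_{n\to\infty}\left[F(t/n)\right]^n$$ is valid in the strong operator topology, locally uniformly with respect to $t\ge0$.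
   Context: Cores are linear subspaces; that $D$ is a core for $A$ means that the closure of $A|_D$ equals the closure of $A$. Chernoff equivalence: let $(T(t))_{t\ge0}$ be a strongly continuous semigroup on a Banach space $X$ with generator $(G,D(G))$. A family $(F(t))_{t\ge0}$ of bounded linear operators on $X$ is Chernoff equivalent to $(T(t))_{t\ge0}$ if $t\mapsto F(t)$ is strongly continuous, $F(0)=\mathrm{Id}$, $\|F(t)\|\le e^{at}$ for some $a\in[0,\infty)$ and all $t\ge0$, and there is a linear subspace $D$ of $D(F'(0))$ such that the restriction of $F'(0)$ to $D$ is closable with closure $(G,D(G))$. Here $F'(0)g=\lim_{t\searrow0}\frac{F(t)g-F(0)g}{t}$, with $D(F'(0))$ the set of all $g\in X$ for which the limit exists. *)

(* Defs.v *)
From HB Require Import structures.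
From mathcomp Require Import all_boot all_order all_algebra.
From mathcomp Require Import all_classical all_reals all_analysis.
From mathcomp Require Import complex.

Set Implicit Arguments.
Unset Strict Implicit.
Unset Printing Implicit Defensive.

Import Order.TTheory GRing.Theory Num.Theory.
Import numFieldNormedType.Exports.

Local Open Scope classical_set_scope.
Local Open Scope ring_scope.

(* A normed space over K has its norm valued in K, whereas time is a real
   parameter. The predicate says that iota identifies R with the real elements
   of the scalar field K, which makes K the field of real or of complex
   numbers. *)
Definition real_scalars (R : realType) (K : numFieldType)
    (iota : {rmorphism R -> K}) : Prop :=
  forall z : K, 0 <= z <-> exists2 r : R, 0 <= r & iota r = z.

Lemma real_scalars_real (R : realType) :
  real_scalars (idfun : {rmorphism R -> R}).
Proof. by move=> z; split=> [z0|[r r0 <-]//]; exists z. Qed.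

Lemma real_scalars_complex (R : realType) :
  real_scalars (real_complex R : {rmorphism R -> R[i]}).
Proof.
move=> z; split=> [z0|[r r0 <-]]; last by rewrite ler0c.
move: z0; case: z => x y; rewrite lecE /= => /andP[/eqP -> x0].
by exists x.
Qed.

Section Operators.
Context (R : realType) (K : numFieldType) (iota : {rmorphism R -> K}).
Context (X : normedModType K).

Definition subspace (D : set X) : Prop :=
  D 0 /\ forall (a : K) (x y : X), D x -> D y -> D (a *: x + y).

Definition opnorm_le (f : X -> X) (c : R) : Prop :=
  forall x, `|f x| <= iota c * `|x|.

Definition bounded_linear (f : X -> X) : Prop :=
  linear f /\ exists c : R, opnorm_le f c.

(* Families (F(t))_{t >= 0} are total functions of t : R whose values at t < 0
   are irrelevant. *)
Definition strongly_continuous (F : R -> X -> X) : Prop :=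
  forall x, {within `[0, +oo[%classic, continuous (fun t => F t x)}.

Definition C0_semigroup (T : R -> X -> X) : Prop :=
  [/\ forall t, 0 <= t -> bounded_linear (T t),
      T 0 = id,
      forall s t, 0 <= s -> 0 <= t -> T (s + t) = T s \o T t
    & strongly_continuous T].

(* Possibly unbounded, partially defined operators are given by their graphs:
   A (x, y) means that x belongs to D(A) and A x = y. *)
Definition op_dom (A : set (X * X)) : set X := [set x | exists y, A (x, y)].

Definition op_restrict (A : set (X * X)) (D : set X) : set (X * X) :=
  [set p | A p /\ D p.1].

Definition closable (A : set (X * X)) : Prop :=
  forall x y z, closure A (x, y) -> closure A (x, z) -> y = z.

Definition core (A : set (X * X)) (D : set X) : Prop :=
  [/\ subspace D, D `<=` op_dom A & closure (op_restrict A D) = closure A].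

Definition op_sum (m : nat) (A : 'I_m -> set (X * X)) : set (X * X) :=
  [set p | exists2 y : 'I_m -> X,
             forall k, A k (p.1, y k) & p.2 = \sum_(k < m) y k].

Definition deriv0 (F : R -> X -> X) : set (X * X) :=
  [set p | (iota t)^-1 *: (F t p.1 - F 0 p.1) @[t --> 0^'+] --> p.2].

Definition generator (T : R -> X -> X) : set (X * X) :=
  [set p | (iota t)^-1 *: (T t p.1 - p.1) @[t --> 0^'+] --> p.2].

Definition chernoff_equivalent (F T : R -> X -> X) : Prop :=
  [/\ forall t, 0 <= t -> bounded_linear (F t),
      strongly_continuous F,
      F 0 = id,
      exists2 a : R, 0 <= a &
        forall t, 0 <= t -> opnorm_le (F t) (expR (a * t))
    & exists D : set X,
        [/\ subspace D, D `<=` op_dom (deriv0 F),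
            closable (op_restrict (deriv0 F) D)
          & closure (op_restrict (deriv0 F) D) = generator T]].

End Operators.

(* Main.v *)
Require Import Defs.
From HB Require Import structures.
From mathcomp Require Import all_boot all_order all_algebra.
From mathcomp Require Import all_classical all_reals all_analysis.
From mathcomp Require Import ring lra.

Set Implicit Arguments.
Unset Strict Implicit.
Unset Printing Implicit Defensive.

Import Order.TTheory GRing.Theory Num.Theory.
Import numFieldNormedType.Exports.

Local Open Scope classical_set_scope.
Local Open Scope ring_scope.

(**
  Restricting scalars along iota turns X into a real Banach space with the same
  uniform structure, so the limits may be studied over R.

  By F(t) x - x = F_1(t) (F_2(t) ... F_m(t) x - x) + (F_1(t) x - x) and
  induction on m, F'(0) x = A_1 x + ... + A_m x for x in D; hence the closure
  of the restriction of F'(0) to D is the closure of A, the generator G of T.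

  For the Feynman formula, let x be in D(G). On a grid of mesh d, choose y_i
  in D close to T(i d) x in the graph norm of G, with error o(d), and let y be
  the piecewise linear interpolation of the y_i. Then y' and F'(0) y are both
  uniformly close to T(t) G x, so that |F(s) y(t) - y(t + s)| <= eps s for all
  small s. Since |F(s)^j| <= exp(a j s), these errors add up to
  |F(s)^j x - T(j s) x| = O(eps) for j s <= tau. No invariance of D under T is
  needed, and neither are resolvents. Finally D(G) is dense and |T(t)| is
  bounded on [0, tau], by Banach-Steinhaus.

  Density of D(G) is proved as usual with the averages of t |-> T(t) x over
  [0, h], which are constructed as limits of dyadic Riemann sums.
*)

(** * Restriction of scalars *)

Section RestrictionOfScalars.
Context (R : realType) (K : numFieldType) (iota : {rmorphism R -> K}).
Hypothesis hK : real_scalars iota.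

(** [real_scalars] makes the nonnegative scalars exactly the images of nonnegative reals, and a
    field morphism is injective; hence [iota] also reflects signs. *)
Lemma iota_ge0 (r : R) : (0 <= iota r) = (0 <= r).
Proof.
apply/idP/idP => [/hK[s s0 /fmorph_inj <- //]|r0].
by apply/hK; exists r.
Qed.

Lemma iota_le (r s : R) : (iota r <= iota s) = (r <= s).
Proof. by rewrite -subr_ge0 -rmorphB iota_ge0 subr_ge0. Qed.

Lemma iota_lt (r s : R) : (iota r < iota s) = (r < s).
Proof. by rewrite !lt_neqAle iota_le fmorph_eq. Qed.

Lemma iota_norm (r : R) : `|iota r| = iota `|r|.
Proof.
have [r0|/ltW r0] := leP 0 r; first by rewrite !ger0_norm ?iota_ge0.
by rewrite !ler0_norm ?rmorphN // -oppr_ge0 -rmorphN iota_ge0 oppr_ge0.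
Qed.

(** A norm is a nonnegative scalar, hence in the image of [iota]. The boolean [==] lets [xchoose]
    extract the preimage, which serves as the real norm. *)
Lemma norm_in_iota (X : normedModType K) (x : X) :
  exists r : R, iota r == `|x|.
Proof.
by have /hK[r _ rx] := normr_ge0 x; exists r; apply/eqP.
Qed.

Definition real_norm (X : normedModType K) (x : X) : R :=
  xchoose (norm_in_iota x).

Lemma iota_real_norm (X : normedModType K) (x : X) : iota (real_norm x) = `|x|.
Proof. exact/eqP/(xchooseP (norm_in_iota x)). Qed.

(* X as a normed space over R; its uniform structure is that of X, so that
   topological statements are convertible in X and in its restriction. *)
Definition restrict_scalars (X : normedModType K) & real_scalars iota : Type :=
  X.

Section NormedModule.
Context (X : normedModType K).
Local Notation Y := (restrict_scalars X hK).

HB.instance Definition _ := GRing.Zmodule.copy Y X.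
HB.instance Definition _ := Uniform.copy Y X.
HB.instance Definition _ := Pointed.copy Y X.

Definition real_scale (r : R) (x : Y) : Y := iota r *: (x : X).

Fact real_scaleA a b (v : Y) :
  real_scale a (real_scale b v) = real_scale (a * b) v.
Proof. by rewrite /real_scale scalerA rmorphM. Qed.
Fact real_scale1 : left_id 1 real_scale.
Proof. by move=> v; rewrite /real_scale rmorph1 scale1r. Qed.
Fact real_scaleDr : right_distributive real_scale +%R.
Proof. by move=> a u v; rewrite /real_scale scalerDr. Qed.
Fact real_scaleDl (v : Y) : {morph real_scale^~ v : a b / a + b}.
Proof. by move=> a b; rewrite /real_scale rmorphD scalerDl. Qed.

HB.instance Definition _ := GRing.Zmodule_isLmodule.Build R Y
  real_scaleA real_scale1 real_scaleDr real_scaleDl.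

Fact real_normD (x y : Y) :
  @real_norm X (x + y) <= @real_norm X x + @real_norm X y.
Proof. by rewrite -iota_le rmorphD !iota_real_norm ler_normD. Qed.
Fact real_norm_eq0 (x : Y) : @real_norm X x = 0 -> x = 0.
Proof.
by move=> /(congr1 iota); rewrite iota_real_norm rmorph0 => /normr0_eq0.
Qed.
Fact real_normMn (x : Y) n : @real_norm X (x *+ n) = @real_norm X x *+ n.
Proof.
apply: (@fmorph_inj _ _ iota).
by rewrite iota_real_norm rmorphMn iota_real_norm -normrMn.
Qed.
Fact real_normN (x : Y) : @real_norm X (- x) = @real_norm X x.
Proof. by apply: (@fmorph_inj _ _ iota); rewrite !iota_real_norm normrN. Qed.

HB.instance Definition _ := Num.Zmodule_isNormed.Build R Y
  real_normD real_norm_eq0 real_normMn real_normN.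

Lemma iota_normE (x : Y) : iota `|x| = `|(x : X)|.
Proof. exact: iota_real_norm. Qed.

(** Every positive scalar is the image of a positive real, so the real balls and the balls with
    radius in [K] are the same sets. *)
Fact restrict_scalars_entourage :
  @entourage Y = entourage_ (ball_ (fun x : Y => `|x|)).
Proof.
rewrite -[LHS](@entourage_ballE K X); apply/seteqP; split=> A [e /= e0 eA].
- have /hK[r _ re] := ltW e0.
  exists r => /=; first by rewrite -iota_lt rmorph0 re.
  move=> [x y] xy; apply: eA; move: xy; rewrite /= -ball_normE /=.
  by rewrite -iota_lt iota_normE re.
- exists (iota e) => /=; first by rewrite -(rmorph0 iota) iota_lt.
  move=> [x y] xy; apply: eA; move: xy; rewrite /= -ball_normE /=.
  by rewrite -iota_lt iota_normE.
Qed.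

HB.instance Definition _ := Uniform_isPseudoMetric.Build R Y
  (@ball_norm_center R Y) (@ball_norm_symmetric R Y) (@ball_norm_triangle R Y)
  restrict_scalars_entourage.
HB.instance Definition _ := NormedZmod_PseudoMetric_eq.Build R Y erefl.

Fact real_normZ (l : R) (x : Y) : `|l *: x| = `|l| * `|x|.
Proof.
by apply: (@fmorph_inj _ _ iota); rewrite rmorphM !iota_normE normrZ iota_norm.
Qed.

HB.instance Definition _ :=
  PseudoMetricNormedZmod_Lmodule_isNormedModule.Build R Y real_normZ.

End NormedModule.

Section Complete.
Context (X : completeNormedModType K).
HB.instance Definition _ :=
  Uniform_isComplete.Build (restrict_scalars X hK) (@cauchy_cvg X).
End Complete.

Lemma iota_scaleE (X : normedModType K) (r : R) (x : restrict_scalars X hK) :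
  r *: x = iota r *: (x : X).
Proof. by []. Qed.

End RestrictionOfScalars.

(** * Products of bounded families *)

Section LinearFunctions.
Context (S : pzRingType) (V : lmodType S) (f : V -> V).
Hypothesis lf : linear f.
Let g : {linear V -> V} := HB.pack f (GRing.isLinear.Build S V V _ f lf).

Lemma linear_fun0 : f 0 = 0. Proof. exact: (linear0 g). Qed.
Lemma linear_funD u v : f (u + v) = f u + f v. Proof. exact: (linearD g). Qed.
Lemma linear_funB u v : f (u - v) = f u - f v. Proof. exact: (linearB g). Qed.
Lemma linear_funZ c v : f (c *: v) = c *: f v.
Proof. exact: (linearZ_LR g). Qed.
Lemma linear_fun_sum n (u : 'I_n -> V) :
  f (\sum_(i < n) u i) = \sum_(i < n) f (u i).
Proof. exact: (linear_sum g). Qed.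
End LinearFunctions.

Lemma linear_comp_fun (S : pzRingType) (V : lmodType S) (f g : V -> V) :
  linear f -> linear g -> linear (f \o g).
Proof. by move=> lf lg c u v /=; rewrite lg lf. Qed.

Section BoundedFamilies.
Context (R : realType) (V : normedModType R).

(** Split G u - y = G (u - x) + (G x - y): equiboundedness controls the first term, strong
    convergence the second. *)
Lemma cvg_bounded_op (I : Type) (P : set_system I) (PF : Filter P)
    (G : I -> V -> V) (C : R) (u : I -> V) (x y : V) :
  (\forall i \near P, linear (G i) /\ forall v, `|G i v| <= C * `|v|) ->
  G i x @[i --> P] --> y -> u i @[i --> P] --> x ->
  G i (u i) @[i --> P] --> y.
Proof.
move=> hG Gx ux; apply/subr_cvg0.
have /subr_cvg0 Gx0 := Gx; have /subr_cvg0 ux0 := ux.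
apply/cvgr0Pnorm_le => e e0.
have C0 : 0 < `|C| + 1 by rewrite ltr_wpDl.
have e1 : 0 < e / 2 / (`|C| + 1) by rewrite !divr_gt0.
have e2 : 0 < e / 2 by rewrite divr_gt0.
move/cvgr0Pnorm_le : Gx0 => /(_ _ e2); move/cvgr0Pnorm_le : ux0 => /(_ _ e1).
move: hG; apply: filterS3 => i [lG bG] hu hx.
have -> : G i (u i) - y = G i (u i - x) + (G i x - y).
  by rewrite (linear_funB lG) addrA subrK.
apply: (le_trans (ler_normD _ _)); rewrite [leRHS]splitr lerD //.
apply: (le_trans (bG _)); apply: (@le_trans _ _ ((`|C| + 1) * `|u i - x|)).
  by rewrite ler_wpM2r // (le_trans (ler_norm _)) // lerDl.
by rewrite mulrC -ler_pdivlMr.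
Qed.

Lemma strongly_continuousP (F : R -> V -> V) : strongly_continuous F <->
  forall x (t : R), 0 <= t ->
    F s x @[s --> within `[0, +oo[%classic (nbhs t)] --> F t x.
Proof.
by split=> [hF x t t0|hF x]; [move/subspace_continuousP: (hF x); apply|
  apply/subspace_continuousP => t]; rewrite /= in_itv /= andbT //; exact: hF.
Qed.

Lemma strongly_continuous_right (F : R -> V -> V) x : strongly_continuous F ->
  F s x @[s --> 0^'+] --> F 0 x.
Proof. by move=> /(_ x) /continuous_within_itvcyP[]. Qed.

Section Products.
Context (I : Type) (F : I -> R -> V -> V) (a : I -> R).
Hypothesis lF : forall k (t : R), 0 <= t -> linear (F k t).
Hypothesis bF : forall k (t : R), 0 <= t ->
  forall x, `|F k t x| <= expR (a k * t) * `|x|.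
Hypothesis cF : forall k, strongly_continuous (F k).
Hypothesis F0 : forall k, F k 0 = id.
Local Notation prodF r t := (\big[comp/id]_(k <- r) F k t).

Lemma norm_bigcomp r (t : R) x : 0 <= t ->
  `|prodF r t x| <= expR ((\sum_(k <- r) a k) * t) * `|x|.
Proof.
move=> t0; elim: r => [|k r IH]; first by rewrite !big_nil mul0r expR0 mul1r.
rewrite !big_cons mulrDl expRD -mulrA.
by apply: (le_trans (bF _ t0 _)); rewrite ler_pM2l ?expR_gt0.
Qed.

Lemma bigcomp0 r : prodF r 0 = id.
Proof. by elim: r => [|k r IH]; rewrite ?big_nil // big_cons IH F0. Qed.

(** Provides the locally uniform bound that [cvg_bounded_op] asks for; the absolute value allows for
    a rate of either sign. *)
Lemma family_near_bounded k (t : R) : 0 <= t ->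
  \forall s \near within `[0, +oo[%classic (nbhs t),
    linear (F k s) /\ forall v, `|F k s v| <= expR (`|a k| * (t + 1)) * `|v|.
Proof.
move=> t0; rewrite near_withinE.
have t1 : t < t + 1 by rewrite ltrDl.
apply: filterS (lt_nbhsl t1) => s st1; rewrite /= in_itv /= andbT => s0.
split; first exact: lF.
move=> v; apply: (le_trans (bF _ s0 v)); rewrite ler_wpM2r // ler_expR.
apply: (@le_trans _ _ (`|a k| * s)); first by rewrite ler_wpM2r ?ler_norm.
by apply: ler_wpM2l => //; exact: ltW.
Qed.

Lemma strongly_continuous_bigcomp r : strongly_continuous (fun t => prodF r t).
Proof.
apply/strongly_continuousP => x t t0; elim: r => [|k r IH].
  by under eq_fun do rewrite big_nil; rewrite big_nil; exact: cvg_cst.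
under eq_fun do rewrite big_cons; rewrite big_cons /=.
apply: cvg_bounded_op IH; first exact: family_near_bounded.
by move/strongly_continuousP: (@cF k); apply.
Qed.

Lemma deriv0_bigcomp r x (y : I -> V) :
  (forall k, t^-1 *: (F k t x - x) @[t --> 0^'+] --> y k) ->
  t^-1 *: (prodF r t x - x) @[t --> 0^'+] --> \sum_(k <- r) y k.
Proof.
move=> hy; elim: r => [|k r IH].
  under eq_fun do rewrite big_nil /= subrr scaler0.
  by rewrite big_nil; exact: cvg_cst.
rewrite big_cons addrC.
(* The outer factor acts on the difference quotient of the remaining product; in the limit it
   becomes F_k(0) = id. *)
have hk : F k t (t^-1 *: (prodF r t x - x)) @[t --> 0^'+] -->
    \sum_(k <- r) y k.
  have bk : \forall t \near 0^'+, linear (F k t) /\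
      forall v, `|F k t v| <= expR (`|a k| * (0 + 1)) * `|v|.
    have := family_near_bounded k (lexx 0).
    rewrite !near_withinE; apply: filterS => s hs s0.
    by apply: hs; rewrite /= in_itv /= andbT ltW.
  apply: (cvg_bounded_op _ bk _ IH).
  rewrite -[X in _ --> X]/(id _) -(F0 k).
  exact: strongly_continuous_right.
apply: cvg_trans (cvgD hk (hy k)); apply: near_eq_cvg.
near=> t; rewrite big_cons /=.
have t0 : 0 <= t by near: t; exact: nbhs_right_ge.
rewrite fctE.
rewrite (linear_funZ (lF k t0)) (linear_funB (lF k t0)).
by rewrite -scalerDr addrA subrK.
Unshelve. all: by end_near. Qed.
End Products.
End BoundedFamilies.

(** * Piecewise linear interpolation *)

Section Interpolation.
Context (R : realType) (V : normedModType R).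

(** [u] is an approximate orbit with one-step defect [b]; every defect is carried along by at most
    [n] applications of [f], each costing a factor exp(c). *)
Lemma iter_stability (f : V -> V) (u : nat -> V) (c b : R) x n :
  linear f -> (forall v, `|f v| <= expR c * `|v|) -> 0 <= c -> 0 <= b ->
  (forall j, (j < n)%N -> `|f (u j) - u j.+1| <= b) ->
  `|iter n f x - u n| <= expR (n%:R * c) * (`|x - u 0| + n%:R * b).
Proof.
move=> lf bf c0 b0; elim: n => [|n IH] hu.
  by rewrite mul0r expR0 mul1r mul0r addr0.
have -> : iter n.+1 f x - u n.+1 = f (iter n f x - u n) + (f (u n) - u n.+1).
  by rewrite (linear_funB lf) addrA subrK.
have {}IH := IH (fun j jn => hu j (ltnW jn)).
apply: (le_trans (ler_normD _ _)).
apply: (@le_trans _ _ (expR (n.+1%:R * c) * (`|x - u 0| + n%:R * b) + b)).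
  apply: lerD; last exact: hu.
  have -> : expR (n.+1%:R * c) = expR c * expR (n%:R * c).
    by rewrite -expRD -natr1 mulrDl mul1r addrC.
  apply: (le_trans (bf _)); rewrite -mulrA.
  by rewrite ler_pM2l ?expR_gt0.
(* The new defect is absorbed because exp((n+1)c) is at least 1. *)
have -> : n.+1%:R * b = n%:R * b + b by rewrite -natr1 mulrDl mul1r.
rewrite [X in _ <= _ * X]addrA [leRHS]mulrDr lerD2l ler_peMl //.
by rewrite -expR0 ler_expR mulr_ge0.
Qed.

Definition interpolate (d : R) (y : nat -> V) (t : R) : V :=
  let i := Num.truncn (t / d) in y i + (t / d - i%:R) *: (y i.+1 - y i).

Lemma norm_convex_le (u v : V) (th c : R) : 0 <= th <= 1 ->
  `|u| <= c -> `|v| <= c -> `|u + th *: (v - u)| <= c.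
Proof.
move=> /andP[th0 th1] uc vc.
have -> : u + th *: (v - u) = (1 - th) *: u + th *: v.
  by rewrite scalerBr scalerBl scale1r addrA addrAC.
apply: (le_trans (ler_normD _ _)); rewrite !normrZ !ger0_norm ?subr_ge0 //.
apply: (@le_trans _ _ ((1 - th) * c + th * c)).
  by apply: lerD; apply: ler_wpM2l => //; rewrite subr_ge0.
by rewrite -mulrDl subrK mul1r.
Qed.

Section Step.
Context (d t s : R) (y : nat -> V).
Hypotheses (d0 : 0 < d) (t0 : 0 <= t) (s0 : 0 <= s) (sd : s <= d).
Let i := Num.truncn (t / d).

Let th01 : 0 <= t / d - i%:R <= 1.
Proof.
have /andP[it ti] : i%:R <= t / d < i.+1%:R.
  by apply: truncn_itv; rewrite divr_ge0 // ltW.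
by rewrite subr_ge0 it /= lerBlDr addrC natr1 ltW.
Qed.

Lemma interpolate_near q c : `|y i - q| <= c -> `|y i.+1 - q| <= c ->
  `|interpolate d y t - q| <= c.
Proof.
move=> h0 h1; rewrite /interpolate -/i.
have -> : y i + (t / d - i%:R) *: (y i.+1 - y i) - q =
    (y i - q) + (t / d - i%:R) *: ((y i.+1 - q) - (y i - q)).
  by rewrite [- (y i - q)]opprB addrA subrK addrAC.
exact: norm_convex_le.
Qed.

(** As s <= d, the shifted point is in the same cell, where the increment is exact, or in the next
    one, where the change of slope enters through a second difference. *)
Lemma interpolate_shift :
  `|interpolate d y (t + s) - interpolate d y t - (s / d) *: (y i.+1 - y i)|
  <= s / d * `|(y i.+2 - y i.+1) - (y i.+1 - y i)|.
Proof.
rewrite /interpolate -/i mulrDl.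
have sd0 : 0 <= s / d by rewrite divr_ge0 // ltW.
have sd1 : s / d <= 1 by rewrite ler_pdivrMr // mul1r.
have td0 : 0 <= t / d by rewrite divr_ge0 // ltW.
have /andP[it ti] : i%:R <= t / d < i.+1%:R := truncn_itv td0.
set D := y i.+1 - y i.
have [lt_i|ge_i] := ltP (t / d + s / d) i.+1%:R.
  have -> : Num.truncn (t / d + s / d) = i.
    by apply: truncn_def; rewrite lt_i (le_trans it) // lerDl.
  have -> : y i + (t / d + s / d - i%:R) *: D - (y i + (t / d - i%:R) *: D)
      - (s / d) *: D = 0.
    rewrite opprD addrACA subrr add0r -!scalerBl.
    have -> : t / d + s / d - i%:R - (t / d - i%:R) - s / d = 0 by ring.
    by rewrite scale0r.
  by rewrite normr0 mulr_ge0.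
have -> : Num.truncn (t / d + s / d) = i.+1.
  apply: truncn_def; rewrite ge_i /= -[i.+2%:R]natr1.
  by rewrite ltr_leD.
set D' := y i.+2 - y i.+1.
(* Only the part of the shift beyond node i+1 has slope [D'], and this part is at most s/d because
   t/d < i+1. *)
have -> : y i.+1 + (t / d + s / d - i.+1%:R) *: D' - (y i + (t / d - i%:R) *: D)
    - (s / d) *: D = (t / d + s / d - i.+1%:R) *: (D' - D).
  have HD : (t / d + s / d - i.+1%:R) *: D + D =
      (t / d - i%:R) *: D + (s / d) *: D.
    rewrite -[RHS]scalerDl.
    have -> : t / d - i%:R + s / d = t / d + s / d - i.+1%:R + 1.
      by rewrite -(natr1 i); ring.
    by rewrite [RHS]scalerDl scale1r.
  have -> : y i.+1 = y i + D by rewrite addrC subrK.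
  rewrite -addrA -opprD -[y i + _ + (s / d) *: D]addrA -HD [RHS]scalerBr.
  by rewrite [_ *: D + D]addrC [y i + (D + _)]addrA opprD addrACA subrr add0r.
rewrite normrZ ger0_norm ?subr_ge0 //; apply: ler_wpM2r => //.
by rewrite lerBlDr addrC lerD2l ltW.
Qed.

(** [p] approximates both the generator applied to the nodes (error [A]) and the slopes in the
    current and the next cell (errors [B], [C]). [B] counts twice: once for the slope itself, once
    in the second difference. *)
Lemma interpolate_consistent (f : V -> V) (p : V) (A B C : R) : linear f ->
  `|f (y i) - y i - s *: p| <= s * A ->
  `|f (y i.+1) - y i.+1 - s *: p| <= s * A ->
  `|(y i.+1 - y i) - d *: p| <= d * B ->
  `|(y i.+2 - y i.+1) - d *: p| <= d * C ->
  `|f (interpolate d y t) - interpolate d y (t + s)| <= s * (A + 2 * B + C).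
Proof.
move=> lf h1 h2 h3 h4.
have dn0 : d != 0 by rewrite gt_eqF.
set v := interpolate d y t; set v' := interpolate d y (t + s).
set D := y i.+1 - y i.
have -> : f v - v' = (f v - v - s *: p) -
    ((v' - v - (s / d) *: D) + (s / d) *: (D - d *: p)).
  rewrite (scalerBr _ D) scalerA divfK // addrA subrK.
  by do 2! rewrite opprB addrA subrK.
(* This defect is affine in [v], so by convexity of balls the bounds at the two nodes suffice. *)
have H1 : `|f v - v - s *: p| <= s * A.
  have -> : f v - v - s *: p = (f (y i) - y i - s *: p) + (t / d - i%:R) *:
      ((f (y i.+1) - y i.+1 - s *: p) - (f (y i) - y i - s *: p)).
    rewrite /v /interpolate -/i (linear_funD lf) (linear_funZ lf).
    rewrite (linear_funB lf) [X in _ = _ + _ *: X](_ : _ =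
      (f (y i.+1) - f (y i)) - (y i.+1 - y i)).
      by rewrite [in RHS]scalerBr [in LHS]opprD [in LHS]addrACA [LHS]addrAC.
    by rewrite opprB addrA subrK opprD addrACA -opprD.
  exact: norm_convex_le.
have H2 : `|v' - v - (s / d) *: D| <= s * (B + C).
  apply: (le_trans interpolate_shift).
  rewrite -mulrA ler_wpM2l // mulrC ler_pdivrMr // mulrDl.
  have -> : (y i.+2 - y i.+1) - (y i.+1 - y i) =
      (y i.+2 - y i.+1 - d *: p) - (y i.+1 - y i - d *: p).
    by rewrite [in RHS]opprB addrA subrK.
  by apply: (le_trans (ler_normB _ _)); rewrite addrC lerD // mulrC.
have H3 : `|(s / d) *: (D - d *: p)| <= s * B.
  rewrite normrZ ger0_norm ?divr_ge0 ?(ltW d0) // -mulrA ler_wpM2l //.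
  by rewrite mulrC ler_pdivrMr // mulrC.
apply: (le_trans (ler_normB _ _)).
apply: (le_trans (lerD H1 (le_trans (ler_normD _ _) (lerD H2 H3)))).
by rewrite -!mulrDr; apply: ler_wpM2l => //; lra.
Qed.
End Step.
End Interpolation.

(** * Strongly continuous semigroups *)

Section Semigroups.
Context (R : realType) (V : completeNormedModType R).
Local Notation idR := (idfun : {rmorphism R -> R}).
Context (T : R -> V -> V).
Hypothesis hT : C0_semigroup idR T.

Let lT (t : R) : 0 <= t -> linear (T t).
Proof. by case: hT => h _ _ _ /h[]. Qed.

Let T0 : T 0 = id.
Proof. by case: hT. Qed.

Let TD (s t : R) x : 0 <= s -> 0 <= t -> T (s + t) x = T s (T t x).
Proof. by case: hT => _ _ h _ s0 t0; rewrite h. Qed.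

Let cT : strongly_continuous T.
Proof. by case: hT. Qed.

(** * Local boundedness, right continuity and invariance of the domain *)

Lemma C0_semigroup_locally_bounded (tau : R) :
  exists2 M, 0 < M & forall t x, 0 <= t <= tau -> `|T t x| <= M * `|x|.
Proof.
pose F := [set T t | t in `[0, tau]%classic].
(* An orbit over the compact interval is compact by continuity, hence bounded; Banach-Steinhaus then
   makes the bound uniform on the unit ball. *)
have pF : pointwise_bounded F.
  move=> x; have cx : {within `[0, tau]%classic, continuous (T ^~ x)}.
    apply: continuous_subspaceW (@cT x).
    by move=> t /=; rewrite !in_itv /= andbT => /andP[].
  have [M [_ hM]] :=
    compact_bounded (continuous_compact cx (@segment_compact _ _ _)).
  exists (M + 1) => _ [t t0 <-]; apply: (hM (M + 1)); first by rewrite ltrDl.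
  by exists t.
have bF f : F f -> bounded_fun_norm f /\ linear f.
  case=> t; rewrite /= in_itv /= => /andP[t0 _] <-; split; last exact: lT.
  case: hT => /(_ t t0)[_ [c hc]] _ _ _ r.
  exists (`|c| * r) => x xr; apply: (le_trans (hc x)).
  apply: (@le_trans _ _ (`|c| * `|x|)); last exact: ler_wpM2l.
  by apply: ler_wpM2r => //; exact: ler_norm.
have [M hM] := Banach_Steinhauss bF pF 1.
exists (`|M| + 1) => [|t x /andP[t0 tt]]; first by rewrite ltr_wpDl.
have Ft : F (T t) by exists t => //; rewrite /= in_itv /= t0.
have [->|x0] := eqVneq x 0.
  by rewrite (linear_fun0 (lT t0)) !normr0 mulr0.
have nx0 : 0 < `|x| by rewrite normr_gt0.
rewrite -ler_pdivrMr //.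
have := hM _ Ft (`|x|^-1 *: x).
rewrite (linear_funZ (lT t0)) !normrZ gtr0_norm ?invr_gt0 // mulVf ?gt_eqF //.
move=> /(_ (lexx _)); rewrite mulrC => /le_trans; apply.
by rewrite (le_trans (ler_norm _)) // lerDl.
Qed.

Lemma C0_semigroup_right_continuous x (e : R) : 0 < e ->
  exists2 d, 0 < d & forall r, 0 <= r <= d -> `|T r x - x| <= e.
Proof.
move=> e0.
have /cvgrPdist_le/(_ e e0) := @strongly_continuous_right _ _ _ x (@cT).
rewrite T0 near_withinE => -[d /= d0 hd].
exists (d / 2) => [|r /andP[r0 rd]]; first by rewrite divr_gt0.
move: r0; rewrite le_eqVlt => /predU1P[<-|r0].
  by rewrite T0 subrr normr0 ltW.
rewrite distrC; apply: hd => //=; rewrite sub0r normrN gtr0_norm //.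
by rewrite (le_lt_trans rd) // ltr_pdivrMr // ltr_pMr // ltr1n.
Qed.

(** [T t] is bounded and commutes with the difference quotients at 0. *)
Lemma generator_invariant x w t : 0 <= t ->
  generator idR T (x, w) -> generator idR T (T t x, T t w).
Proof.
move=> t0; rewrite /generator /= => xw.
have [M M0 hM] := C0_semigroup_locally_bounded t.
have bt : \forall s \near (0 : R)^'+,
    linear (T t) /\ forall v, `|T t v| <= M * `|v|.
  by apply: nearW => _; split; [exact: lT|move=> v; apply: hM; rewrite t0 lexx].
apply: cvg_trans (cvg_bounded_op (G := fun=> T t) _ bt (cvg_cst _) xw).
apply: near_eq_cvg; near=> s => /=.
have s0 : 0 <= s by near: s; exact: nbhs_right_ge.
rewrite (linear_funZ (lT t0)) (linear_funB (lT t0)).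
by rewrite -(TD _ t0 s0) [t + s]addrC (TD _ s0 t0).
Unshelve. all: by end_near. Qed.

(** * Riemann sums of orbits *)

(** The left Riemann sum of t |-> T(t) x over [0, N d] without its factor [d], so that the
    identities below are purely additive. *)
Definition riemann_sum d N x := \sum_(j < N) T (j%:R * d) x.

Lemma riemann_sumD d N P x : 0 <= d ->
  riemann_sum d (N + P) x =
  riemann_sum d N x + T (N%:R * d) (riemann_sum d P x).
Proof.
move=> d0; rewrite /riemann_sum big_split_ord /=; congr (_ + _).
rewrite (linear_fun_sum (lT _)) ?mulr_ge0 //; apply: eq_bigr => j _.
by rewrite natrD mulrDl TD ?mulr_ge0.
Qed.

(** The fine grid splits into [N] blocks of [P] points, each a translate of the first; this compares
    a dyadic sum with its refinements. *)
Lemma riemann_sumM d N P x : 0 <= d ->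
  riemann_sum d (N * P) x = riemann_sum (P%:R * d) N (riemann_sum d P x).
Proof.
move=> d0; elim: N => [|N IH]; first by rewrite /riemann_sum !big_ord0.
rewrite mulSnr riemann_sumD // IH -[in RHS]addn1 riemann_sumD ?mulr_ge0 //.
congr (_ + _); rewrite [in RHS]/riemann_sum big_ord1 mul0r T0.
by rewrite natrM mulrA.
Qed.

Lemma riemann_sumB d N x y : 0 <= d ->
  riemann_sum d N (x - y) = riemann_sum d N x - riemann_sum d N y.
Proof.
move=> d0; rewrite /riemann_sum -sumrB; apply: eq_bigr => j _.
by rewrite (linear_funB (lT _)) ?mulr_ge0.
Qed.

Lemma riemann_sumZ d N c x : 0 <= d ->
  riemann_sum d N (c *: x) = c *: riemann_sum d N x.
Proof.
move=> d0; rewrite /riemann_sum scaler_sumr; apply: eq_bigr => j _.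
by rewrite (linear_funZ (lT _)) ?mulr_ge0.
Qed.

(* Both sides are S(N + P) - S(N) - S(P). *)
Lemma riemann_sum_shift d N P x : 0 <= d ->
  T (P%:R * d) (riemann_sum d N x) - riemann_sum d N x =
  T (N%:R * d) (riemann_sum d P x) - riemann_sum d P x.
Proof.
move=> d0; apply/eqP; rewrite subr_eq addrAC eq_sym subr_eq eq_sym.
by rewrite addrC -riemann_sumD // addnC riemann_sumD // addrC.
Qed.

Lemma norm_riemann_sum d N x M : 0 <= d ->
  (forall t v, 0 <= t <= N%:R * d -> `|T t v| <= M * `|v|) ->
  `|riemann_sum d N x| <= N%:R * (M * `|x|).
Proof.
move=> d0 hM; apply: (le_trans (ler_norm_sum _ _ _)).
rewrite mulr_natl -[X in _ *+ X]card_ord -sumr_const; apply: ler_sum => j _.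
by apply: hM; rewrite mulr_ge0 //= ler_wpM2r // ler_nat ltnW.
Qed.

Lemma riemann_sum_near d N x e : 0 <= d ->
  (forall r, 0 <= r <= N%:R * d -> `|T r x - x| <= e) ->
  `|riemann_sum d N x - N%:R *: x| <= N%:R * e.
Proof.
move=> d0 he; rewrite scaler_nat -[X in _ *+ X]card_ord -sumr_const -sumrB.
apply: (le_trans (ler_norm_sum _ _ _)).
rewrite mulr_natl -[X in _ *+ X]card_ord -sumr_const; apply: ler_sum => j _.
by apply: he; rewrite mulr_ge0 //= ler_wpM2r // ler_nat ltnW.
Qed.

Lemma norm_riemann_mean d N x M : 0 <= d -> (0 < N)%N ->
  (forall t v, 0 <= t <= N%:R * d -> `|T t v| <= M * `|v|) ->
  `|N%:R^-1 *: riemann_sum d N x| <= M * `|x|.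
Proof.
move=> d0 N0 hM.
rewrite normrZ ger0_norm ?invr_ge0 // mulrC ler_pdivrMr ?ltr0n //.
by rewrite mulrC norm_riemann_sum.
Qed.

Lemma riemann_mean_near d N x e : 0 <= d -> (0 < N)%N ->
  (forall r, 0 <= r <= N%:R * d -> `|T r x - x| <= e) ->
  `|N%:R^-1 *: riemann_sum d N x - x| <= e.
Proof.
move=> d0 N0 he.
have NN0 : N%:R != 0 :> R by rewrite pnatr_eq0 -lt0n.
have -> : N%:R^-1 *: riemann_sum d N x - x =
          N%:R^-1 *: (riemann_sum d N x - N%:R *: x).
  by rewrite scalerBr scalerA mulVf // scale1r.
rewrite normrZ ger0_norm ?invr_ge0 // mulrC ler_pdivrMr ?ltr0n //.
by rewrite mulrC riemann_sum_near.
Qed.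

(** * Averages of an orbit as limits of dyadic means *)

Section DyadicMeans.
Context (x : V) (h M : R).
Hypotheses (h0 : 0 < h) (h1 : h <= 1) (M0 : 0 < M).
Hypothesis hM : forall t v, 0 <= t <= 1 -> `|T t v| <= M * `|v|.
Let d n : R := h / (2 ^ n)%:R.
(** The mean of the orbit over 2^n equidistant times in [0, h); its limit [z] below is the average
    of T(t) x over [0, h]. *)
Let S n := (2 ^ n)%:R^-1 *: riemann_sum (d n) (2 ^ n) x.

Let N0 n : (2 ^ n)%:R != 0 :> R.
Proof. by rewrite pnatr_eq0 -lt0n expn_gt0. Qed.

Let d0 n : 0 < d n.
Proof. by rewrite divr_gt0 // ltr0n expn_gt0. Qed.

Let dN n : (2 ^ n)%:R * d n = h.
Proof. by rewrite mulrC divfK. Qed.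

Let d_cvg0 : d n @[n --> \oo] --> (0 : R).
Proof.
have -> : d = geometric h 2^-1.
  by apply/funext => n; rewrite /d /geometric /= natrX exprVn.
by apply: cvg_geometric; rewrite ger0_norm // invf_lt1 // ltr1n.
Qed.

Let d_refine n k : (2 ^ k)%:R * d (n + k) = d n.
Proof.
rewrite /d expnD natrM; move: (N0 n) (N0 k).
by move: (2 ^ n)%:R (2 ^ k)%:R => a b a0 b0; field; rewrite a0 b0.
Qed.

(** Refining replaces the sample [x] in each coarse cell by its mean over that cell; only the
    deviation of this mean from [x] remains. *)
Let S_refine n k : S (n + k) - S n = (2 ^ n)%:R^-1 *: riemann_sum (d n) (2 ^ n)
  ((2 ^ k)%:R^-1 *: riemann_sum (d (n + k)) (2 ^ k) x - x).
Proof.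
rewrite riemann_sumB ?riemann_sumZ ?(ltW (d0 _)) // scalerBr; congr (_ - _).
rewrite /S scalerA -invfM -natrM -expnD; congr (_ *: _).
by rewrite expnD riemann_sumM ?(ltW (d0 _)) // d_refine.
Qed.

Let S_cvg : cvg (S n @[n --> \oo]).
Proof.
apply/cauchy_cvgP/cauchy_exP => e e0.
(* Within one coarse cell the orbit moves by at most e/(2M), and the coarse mean has norm at most
   [M]. *)
have eM0 : 0 < e / 2 / M by rewrite !divr_gt0.
have [r r0 hr] := C0_semigroup_right_continuous x eM0.
have [n _ /(_ n (leqnn n)) dnr] : \forall n \near \oo, d n <= r.
  by move/cvgr0_norm_le: d_cvg0 => /(_ r r0); apply: filterS => n /ler_normlW.
exists (S n); exists n => // m /= nm.
rewrite -(subnKC nm) -ball_normE /= distrC S_refine.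
apply: (@le_lt_trans _ _ (e / 2)); last first.
  by rewrite ltr_pdivrMr // ltr_pMr // ltr1n.
apply: (@le_trans _ _ (M * (e / 2 / M))); last by rewrite mulrC divfK ?gt_eqF.
apply: (le_trans (norm_riemann_mean (M := M) _ _ _ _)).
- exact: ltW.
- by rewrite expn_gt0.
- move=> t v; rewrite dN => /andP[t0 th]; apply: hM.
  by rewrite t0 (le_trans th).
rewrite ler_pM2l //; apply: riemann_mean_near.
- exact: ltW.
- by rewrite expn_gt0.
move=> s; rewrite d_refine => /andP[s0 sd]; apply: hr.
by rewrite s0 (le_trans sd).
Qed.

Let z := lim (S n @[n --> \oo]).

Let S_cvgz : S n @[n --> \oo] --> z.
Proof. exact: S_cvg. Qed.

Let z_near e : (forall r, 0 <= r <= h -> `|T r x - x| <= e) -> `|z - x| <= e.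
Proof.
move=> he; apply: (@ler_cvg_to _ \oo _ R (fun n => `|S n - x|) (fun=> e)).
- by apply: cvg_norm; apply: cvgB => //; exact: cvg_cst.
- exact: cvg_cst.
- apply: nearW => n; apply: riemann_mean_near; rewrite ?expn_gt0 ?dN //.
  exact: ltW.
Qed.

(** Discrete form of T(r) z - z = (1/h) (T(h) - 1) applied to the integral of T(t) x over [0, r],
    with r rounded down to the grid. Replacing the short sum by p x costs p e, and T(h) - 1 has norm
    at most M + 1. *)
Let S_difference r e n (p := Num.truncn (r / d n)) : 0 < r ->
  (forall s, 0 <= s <= r -> `|T s x - x| <= e) ->
  `|T (p%:R * d n) (S n) - S n - (p%:R * d n / h) *: (T h x - x)|
    <= p%:R * d n / h * ((M + 1) * e).
Proof.
move=> r0 he; have dn0 := ltW (d0 n).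
have rd0 : 0 <= r / d n by rewrite divr_ge0 ?ltW.
have pr : p%:R * d n <= r.
  by rewrite -ler_pdivlMr //; have /andP[] := truncn_itv rd0.
have pd0 : 0 <= p%:R * d n by rewrite mulr_ge0.
have lp := lT pd0; have lh := lT (ltW h0).
set u := riemann_sum (d n) p x - p%:R *: x.
have hu : `|u| <= p%:R * e.
  apply: riemann_sum_near => // s /andP[s0 sp]; apply: he.
  by rewrite s0 (le_trans sp).
have dE : (2 ^ n)%:R^-1 = d n / h by rewrite /d mulrAC mulfV ?mul1r ?gt_eqF.
rewrite /S (linear_funZ lp) -scalerBr riemann_sum_shift // dN dE.
have -> : p%:R * d n / h = d n / h * p%:R by rewrite -mulrA mulrC.
rewrite -scalerA -scalerBr normrZ ger0_norm ?divr_ge0 ?(ltW h0) //.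
rewrite -mulrA ler_wpM2l ?divr_ge0 ?(ltW h0) //.
have -> : T h (riemann_sum (d n) p x) - riemann_sum (d n) p x -
    p%:R *: (T h x - x) = T h u - u.
  rewrite /u (linear_funB lh) (linear_funZ lh) scalerBr !opprB.
  by rewrite addrACA [RHS]addrACA; congr (_ + _); exact: addrC.
apply: (le_trans (ler_normB _ _)).
apply: (@le_trans _ _ ((M + 1) * `|u|)).
  rewrite mulrDl mul1r lerD2r; apply: hM.
  by rewrite (ltW h0).
by rewrite mulrCA ler_pM2l // addr_gt0.
Qed.

(** The limit of [S_difference] as the mesh tends to 0; the rounded times [q n] are squeezed between
    r - d n and r. *)
Let z_difference r e : 0 < r <= 1 ->
  (forall s, 0 <= s <= r -> `|T s x - x| <= e) ->
  `|T r z - z - (r / h) *: (T h x - x)| <= r / h * ((M + 1) * e).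
Proof.
move=> /andP[r0 r1] he; pose q n := (Num.truncn (r / d n))%:R * d n.
have rd0 n : 0 <= r / d n by rewrite divr_ge0 ?ltW.
have q0 n : 0 <= q n by rewrite mulr_ge0 // ltW.
have qr n : q n <= r.
  by rewrite -ler_pdivlMr //; have /andP[] := truncn_itv (rd0 n).
have rq n : r - d n <= q n.
  rewrite lerBlDr -[X in _ + X]mul1r -mulrDl natr1 -ler_pdivrMr // ltW //.
  by have /andP[] := truncn_itv (rd0 n).
have q_cvg : q n @[n --> \oo] --> r.
  apply: (@squeeze_cvgr _ _ _ _ (fun n => r - d n) (fun=> r)).
  - by apply: nearW => n; rewrite rq qr.
  - by rewrite -[X in _ --> X]subr0; apply: cvgB => //; exact: cvg_cst.
  - exact: cvg_cst.
have Tq v : T (q n) v @[n --> \oo] --> T r v.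
  have /continuous_within_itvcyP[/(_ r) cr _] := @cT v.
  have rr : r \in `]0, +oo[ by rewrite in_itv /= r0.
  exact: (cvg_comp _ _ q_cvg (cr rr)).
have TqS : T (q n) (S n) @[n --> \oo] --> T r z.
  have bq : \forall n \near \oo,
      linear (T (q n)) /\ forall v, `|T (q n) v| <= M * `|v|.
    apply: nearW => n; split; first exact: lT.
    by move=> v; apply: hM; rewrite q0 (le_trans (qr n)).
  exact: (cvg_bounded_op _ bq (Tq z) S_cvgz).
apply: (@ler_cvg_to _ \oo _ R
  (fun n => `|T (q n) (S n) - S n - (q n / h) *: (T h x - x)|)
  (fun n => q n / h * ((M + 1) * e))).
- apply: cvg_norm; apply: cvgB; first exact: cvgB.
  by apply: cvgZr_tmp; apply: cvgMr_tmp.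
- by apply: cvgMr_tmp; apply: cvgMr_tmp.
- by apply: nearW => n; exact: S_difference.
Qed.

Lemma dyadic_mean_generator e : (forall r, 0 <= r <= h -> `|T r x - x| <= e) ->
  exists zw, generator idR T zw /\ `|zw.1 - x| <= e.
Proof.
move=> he; exists (z, h^-1 *: (T h x - x)); split; last exact: z_near.
rewrite /generator /=; apply/cvgrPdist_le => eps eps0.
have M10 : 0 < M + 1 by rewrite addr_gt0.
(* Chosen so that the bound s/h (M+1) eta of [z_difference] equals s eps. *)
have eta0 : 0 < eps * h / (M + 1) by rewrite divr_gt0 // mulr_gt0.
have [r r0 hr] := C0_semigroup_right_continuous x eta0.
near=> s.
have s0 : 0 < s by near: s; exact: nbhs_right_gt.
have s1 : s <= 1 by near: s; exact: nbhs_right_le.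
have sr : s <= r by near: s; exact: nbhs_right_le.
have s01 : 0 < s <= 1 by rewrite s0.
have /(z_difference s01) : forall t, 0 <= t <= s ->
    `|T t x - x| <= eps * h / (M + 1).
  by move=> t /andP[t0 ts]; apply: hr; rewrite t0 (le_trans ts).
move=> hs; rewrite /= distrC.
have -> : s^-1 *: (T s z - z) - h^-1 *: (T h x - x) =
    s^-1 *: (T s z - z - (s / h) *: (T h x - x)).
  by rewrite [in RHS]scalerBr scalerA mulrA mulVf ?mul1r ?gt_eqF.
rewrite normrZ gtr0_norm ?invr_gt0 // mulrC ler_pdivrMr //.
apply: (le_trans hs); rewrite le_eqVlt; apply/orP; left; apply/eqP.
by field; rewrite !gt_eqF.
Unshelve. all: by end_near. Qed.
End DyadicMeans.

Lemma generator_dense x e : 0 < e ->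
  exists zw, generator idR T zw /\ `|zw.1 - x| <= e.
Proof.
move=> e0; have [M M0 hM] := C0_semigroup_locally_bounded 1.
have [h h0 hh] := C0_semigroup_right_continuous x e0.
(* The length is capped at 1 because [M] bounds the semigroup on [0, 1]. *)
apply: (@dyadic_mean_generator x (Num.min h 1) M) => //.
- by rewrite lt_min h0 ltr01.
- by rewrite ge_min lexx orbT.
- by move=> r /andP[r0]; rewrite le_min => /andP[rh _]; apply: hh; rewrite r0.
Qed.

(** * Chernoff's theorem *)

Section Chernoff.
Context (F : R -> V -> V) (a : R).
Hypothesis a0 : 0 <= a.
Hypothesis lF : forall t : R, 0 <= t -> linear (F t).
Hypothesis bF : forall t : R, 0 <= t ->
  forall v, `|F t v| <= expR (a * t) * `|v|.
Hypothesis F0 : F 0 = id.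
Hypothesis coreF : generator idR T `<=` closure (Defs.deriv0 idR F).

Let difference_quotient_le (G : R -> V -> V) (x w : V) (e : R) : 0 < e ->
  t^-1 *: (G t x - x) @[t --> 0^'+] --> w ->
  exists2 s0, 0 < s0 & forall s, 0 < s <= s0 -> `|G s x - x - s *: w| <= s * e.
Proof.
move=> e0 /cvgrPdist_le/(_ e e0); rewrite near_withinE => -[d /= d0 hd].
exists (d / 2) => [|s /andP[s0 sd]]; first by rewrite divr_gt0.
have {hd} : `|w - s^-1 *: (G s x - x)| <= e.
  apply: hd => //=; rewrite sub0r normrN gtr0_norm //.
  by rewrite (le_lt_trans sd) // ltr_pdivrMr // ltr_pMr // ltr1n.
have -> : G s x - x - s *: w = - (s *: (w - s^-1 *: (G s x - x))).
  by rewrite [in RHS]scalerBr scalerA mulfV ?gt_eqF // scale1r opprB.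
by rewrite normrN normrZ gtr0_norm // ler_pM2l.
Qed.

(** Finitely many thresholds have a positive minimum; this gives one step bound for all nodes up to
    the time horizon. *)
Let uniform_small (P : nat -> R -> Prop) n :
  (forall i, exists2 s0, 0 < s0 & forall s, 0 < s <= s0 -> P i s) ->
  exists2 s0, 0 < s0 & forall i s, (i <= n)%N -> 0 < s <= s0 -> P i s.
Proof.
move=> hP; elim: n => [|n [r r0 hr]].
  have [r r0 hr] := hP 0%N; exists r => // i s.
  by rewrite leqn0 => /eqP ->; exact: hr.
have [r' r'0 hr'] := hP n.+1; exists (Num.min r r').
  by rewrite lt_min r0.
move=> i s; rewrite le_min leq_eqVlt => /predU1P[->|ni] /and3P[s0 sr sr'].
  by apply: hr'; rewrite s0.
by apply: hr => //; rewrite s0.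
Qed.

Let approximate x w e : 0 < e -> generator idR T (x, w) ->
  exists yz, [/\ Defs.deriv0 idR F yz, `|yz.1 - x| <= e & `|yz.2 - w| <= e].
Proof.
move=> e0 /coreF; rewrite /closure /= => /(_ (ball (x, w) e)).
have : nbhs (x, w) (ball (x, w) e) by exact: nbhsx_ballx.
move=> nb /(_ nb)[[y z] [yz [/=]]].
rewrite -ball_normE /= => xy wz; exists (y, z); split => //=.
  by rewrite distrC ltW.
by rewrite distrC ltW.
Qed.

Lemma chernoff_on_generator (tau M e : R) x w :
  0 <= tau -> 0 < M -> 0 < e ->
  (forall t v, 0 <= t <= tau + 2 -> `|T t v| <= M * `|v|) ->
  generator idR T (x, w) ->
  exists2 s0, 0 < s0 & forall s j, 0 < s <= s0 -> j%:R * s <= tau ->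
    `|iter j (F s) x - T (j%:R * s) x|
      <= (expR (a * tau) * (1 + tau * (8 + 5 * M)) + 1 + M) * e.
Proof.
move=> tau0 M0 e0 hM xw.
have [d1 d10 hd1] := difference_quotient_le e0 xw.
have [d2 d20 hd2] := C0_semigroup_right_continuous w e0.
have [d3 d30 hd3] := C0_semigroup_right_continuous x e0.
(* The mesh controls the difference quotient of T(t) x and the oscillation of T(t) w and T(t) x; d
   <= 1 keeps the grid times at which [T] is bounded within tau + 2. *)
pose d := Num.min (Num.min d1 d2) (Num.min d3 1).
have d0 : 0 < d by rewrite !lt_min d10 d20 d30 ltr01.
have [dd1 dd2 dd3 dle1] : [/\ d <= d1, d <= d2, d <= d3 & d <= 1].
  by split; rewrite /d !ge_min lexx ?orbT.
have ti0 (i : nat) : 0 <= i%:R * d by rewrite mulr_ge0 // ltW.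
have tiS (i : nat) : i.+1%:R * d = i%:R * d + d by rewrite -natr1 mulrDl mul1r.
have de0 : 0 < d * e by rewrite mulr_gt0.
(* The tolerance [d * e] survives the division by the mesh that occurs when slopes are formed. *)
have [yz hyz] : exists yz : nat -> V * V, forall i,
  [/\ Defs.deriv0 idR F (yz i),
    `|(yz i).1 - T (i%:R * d) x| <= d * e &
    `|(yz i).2 - T (i%:R * d) w| <= d * e].
  have ex i : exists p : V * V, [/\ Defs.deriv0 idR F p,
      `|p.1 - T (i%:R * d) x| <= d * e & `|p.2 - T (i%:R * d) w| <= d * e].
    by apply: approximate => //; exact: generator_invariant.
  by have [f hf] := boolp.choice ex; exists f.
pose y i := (yz i).1; pose z i := (yz i).2.
have hy i : `|y i - T (i%:R * d) x| <= d * e by case: (hyz i).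
have hz i : `|z i - T (i%:R * d) w| <= e.
  by case: (hyz i) => _ _ /le_trans; apply; rewrite ler_piMl // ltW.
have hT' i v : i%:R * d <= tau + 2 -> `|T (i%:R * d) v| <= M * `|v|.
  by move=> it; apply: hM; rewrite ti0.
pose n := Num.truncn (tau / d).
(* The step bound is chosen after the mesh and the nodes. [n] is the last cell meeting [0, tau],
   whose right end is node n+1. *)
have [s1 s10 hs1] : exists2 s1, 0 < s1 & forall i s, (i <= n.+1)%N ->
    0 < s <= s1 -> `|F s (y i) - y i - s *: z i| <= s * e.
  apply: uniform_small => i; apply: difference_quotient_le => //.
  by case: (hyz i) => + _ _; rewrite /Defs.deriv0 /= F0 /y /z; case: (yz i).
(* Slope in cell i against G T(i d) x = T(i d) w: two node errors, plus [M] times the error of the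
   difference quotient at 0. *)
have hTx i : i%:R * d <= tau + 2 ->
    `|y i.+1 - y i - d *: T (i%:R * d) w| <= d * ((2 + M) * e).
  move=> it; have li := lT (ti0 i).
  have -> : y i.+1 - y i - d *: T (i%:R * d) w =
      (y i.+1 - T (i.+1%:R * d) x) - (y i - T (i%:R * d) x)
      + T (i%:R * d) (T d x - x - d *: w).
    rewrite tiS (TD _ (ti0 i) (ltW d0)) 2!(linear_funB li) (linear_funZ li).
    move: (T (i%:R * d) (T d x)) (T (i%:R * d) x) => A B.
    rewrite opprD opprK [X in _ = X + _]addrACA -[RHS]addrA; congr (_ + _).
    by rewrite addrA [- A + B]addrC addrA subrK subrr add0r.
  apply: (le_trans (ler_normD _ _)).
  apply: (le_trans (lerD (le_trans (ler_normB _ _) (lerD (hy _) (hy _)))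
     (hT' _ _ it))).
  have : `|T d x - x - d *: w| <= d * e by apply: hd1; rewrite d0.
  rewrite -(ler_pM2l M0); lra.
have hTw i : i%:R * d <= tau + 2 ->
    `|T (i.+1%:R * d) w - T (i%:R * d) w| <= M * e.
  move=> it; rewrite tiS (TD _ (ti0 i) (ltW d0)) -(linear_funB (lT (ti0 i))).
  apply: (le_trans (hT' _ _ it)); rewrite ler_pM2l //.
  by apply: hd2; rewrite ltW.
exists (Num.min s1 d); first by rewrite lt_min s10.
move=> s j; rewrite le_min => /and3P[s0 ss1 sd] js.
have u_step k : (k < j)%N ->
    `|F s (interpolate d y (k%:R * s)) - interpolate d y (k.+1%:R * s)|
    <= s * ((8 + 5 * M) * e).
  move=> kj; have k0 : 0 <= k%:R * s by rewrite mulr_ge0 // ltW.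
  have ktau : k%:R * s <= tau.
    by apply: le_trans js; rewrite ler_pM2r // ler_nat ltnW.
  pose i := Num.truncn (k%:R * s / d).
  have ile : i%:R * d <= tau.
    apply: le_trans ktau; rewrite -ler_pdivlMr //.
    by have /andP[] := truncn_itv (divr_ge0 k0 (ltW d0)).
  have iin : (i <= n)%N by apply: le_truncn; rewrite ler_pM2r ?invr_gt0.
  have i1 : i%:R * d <= tau + 2 by lra.
  have i2 : i.+1%:R * d <= tau + 2 by rewrite tiS; lra.
  have -> : k.+1%:R * s = k%:R * s + s by rewrite -natr1 mulrDl mul1r.
  (* The errors, in units of [e], are A = B = 2 + M and C = 2 + 2M, the latter because [p] belongs
     to the preceding cell; A + 2B + C = 8 + 5M. *)
  have /le_trans : `|F s (interpolate d y (k%:R * s)) -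
      interpolate d y (k%:R * s + s)|
      <= s * ((2 + M) * e + 2 * ((2 + M) * e) + (2 + 2 * M) * e).
    pose p := T (i%:R * d) w.
    apply: (@interpolate_consistent _ _ _ _ _ _ _ _ _ _ _ p) => //.
    - exact: ltW.
    - exact/lF/ltW.
    - have -> : F s (y i) - y i - s *: T (i%:R * d) w =
          (F s (y i) - y i - s *: z i) + s *: (z i - T (i%:R * d) w).
        by rewrite scalerBr addrA subrK.
      apply: (le_trans (ler_normD _ _)); rewrite normrZ gtr0_norm //.
      have := hs1 i s (leqW iin); rewrite s0 ss1 => /(_ isT).
      have : s * `|z i - T (i%:R * d) w| <= s * e by rewrite ler_pM2l.
      have : 0 <= s * (M * e) by rewrite !mulr_ge0 // ltW.
      lra.
    - have -> : F s (y i.+1) - y i.+1 - s *: T (i%:R * d) w =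
          (F s (y i.+1) - y i.+1 - s *: z i.+1)
          + s *: ((z i.+1 - T (i.+1%:R * d) w)
                  + (T (i.+1%:R * d) w - T (i%:R * d) w)).
        by rewrite addrA subrK scalerBr addrA subrK.
      apply: (le_trans (ler_normD _ _)); rewrite normrZ gtr0_norm //.
      have := hs1 i.+1 s; rewrite ltnS iin s0 ss1 => /(_ isT isT).
      have : s * `|(z i.+1 - T (i.+1%:R * d) w)
                  + (T (i.+1%:R * d) w - T (i%:R * d) w)| <= s * (e + M * e).
        rewrite ler_pM2l //; apply: (le_trans (ler_normD _ _)).
        by apply: lerD => //; exact: hTw.
      lra.
    - exact: hTx.
    - have -> : y i.+2 - y i.+1 - d *: T (i%:R * d) w =
          (y i.+2 - y i.+1 - d *: T (i.+1%:R * d) w)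
          + d *: (T (i.+1%:R * d) w - T (i%:R * d) w).
        by rewrite scalerBr addrA subrK.
      apply: (le_trans (ler_normD _ _)); rewrite normrZ gtr0_norm //.
      have := hTx i.+1 i2.
      have : d * `|T (i.+1%:R * d) w - T (i%:R * d) w| <= d * (M * e).
        by rewrite ler_pM2l //; exact: hTw.
      lra.
  by apply; rewrite ler_pM2l //; lra.
have lFs := lF (ltW s0).
have as0 : 0 <= a * s by rewrite mulr_ge0 // ltW.
have b0 : 0 <= s * ((8 + 5 * M) * e).
  by rewrite !mulr_ge0 ?addr_ge0 ?mulr_ge0 // ltW.
have j0 : 0 <= j%:R * s by rewrite mulr_ge0 // ltW.
have stab := iter_stability (u := fun k => interpolate d y (k%:R * s)) x
  lFs (bF (ltW s0)) as0 b0 u_step.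
(* Both nodes of the cell are near T(t) x: a node error of at most [e], plus [M e] for the orbit
   over a time at most [d3]. Convexity covers the points between. *)
have near_orbit t : 0 <= t <= tau ->
    `|interpolate d y t - T t x| <= (1 + M) * e.
  move=> /andP[t0 tt].
  have /andP[] := truncn_itv (divr_ge0 t0 (ltW d0)).
  set i := Num.truncn (t / d) => it ti.
  have {}it : i%:R * d <= t by rewrite -ler_pdivlMr.
  have {}ti : t <= i.+1%:R * d by rewrite -ler_pdivrMr // ltW.
  have ti' := ti; rewrite tiS in ti'.
  have dele : d * e <= e by rewrite ler_piMl // ltW.
  apply: interpolate_near => //; rewrite -/i.
  - have -> : y i - T t x = (y i - T (i%:R * d) x)
        - T (i%:R * d) (T (t - i%:R * d) x - x).
      rewrite (linear_funB (lT (ti0 i))) -TD ?subr_ge0 //.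
      rewrite [_ + (t - _)]addrC subrK.
      by rewrite opprB addrA subrK.
    apply: (le_trans (ler_normB _ _)).
    have r : 0 <= t - i%:R * d <= d3 by rewrite subr_ge0 it /=; lra.
    have := hd3 _ r; rewrite -(ler_pM2l M0).
    have i1 : i%:R * d <= tau + 2 by lra.
    have := hT' i (T (t - i%:R * d) x - x) i1; have := hy i; lra.
  - have -> : y i.+1 - T t x = (y i.+1 - T (i.+1%:R * d) x)
        + T t (T (i.+1%:R * d - t) x - x).
      rewrite (linear_funB (lT t0)) -TD ?subr_ge0 // [t + _]addrC subrK.
      by rewrite addrA subrK.
    apply: (le_trans (ler_normD _ _)).
    have r : 0 <= i.+1%:R * d - t <= d3 by rewrite subr_ge0 ti /= tiS; lra.
    have := hd3 _ r; rewrite -(ler_pM2l M0).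
    have t2 : 0 <= t <= tau + 2 by rewrite t0; lra.
    have := hM t (T (i.+1%:R * d - t) x - x) t2; have := hy i.+1; lra.
have jst : 0 <= j%:R * s <= tau by rewrite j0.
rewrite -(subrK (interpolate d y (j%:R * s)) (iter j (F s) x)) -addrA.
apply: (le_trans (ler_normD _ _)).
have := near_orbit _ jst.
have xu0 : `|x - interpolate d y (0%:R * s)| <= e.
  rewrite mul0r /interpolate mul0r truncn0 subrr scale0r addr0 distrC.
  have := hy 0%N; rewrite mul0r T0 => /le_trans; apply.
  by rewrite ler_piMl // ltW.
have : `|iter j (F s) x - interpolate d y (j%:R * s)| <=
    expR (a * tau) * ((1 + tau * (8 + 5 * M)) * e).
  apply: (le_trans stab); apply: ler_pM.
  - exact: expR_ge0.
  - by rewrite addr_ge0 // mulr_ge0.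
  - by rewrite ler_expR mulrCA ler_wpM2l.
  - rewrite [leRHS]mulrDl mul1r; apply: lerD => //.
    rewrite [leLHS]mulrA -[leRHS]mulrA; apply: ler_wpM2r => //.
    by rewrite mulr_ge0 // ltW // addr_gt0 ?mulr_gt0.
lra.
Qed.

(** Three-term estimate through a point [z] of the dense domain: [L] bounds the iterates, [M] bounds
    the semigroup, and [C] is the constant of [chernoff_on_generator]. *)
Lemma chernoff_uniform x (tau : R) : 0 <= tau ->
  {uniform `[0, tau]%classic,
    (fun n t => iter n (F (t / n%:R)) x) @ \oo --> (fun t => T t x)}.
Proof.
move=> tau0 P /uniform_nbhs[E [entE EP]].
move: entE; rewrite -entourage_ballE => -[e /= e0 eE].
have [M M0 hM] := C0_semigroup_locally_bounded (tau + 2).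
pose L := expR (a * tau).
have L0 : 0 < L by exact: expR_gt0.
pose C := L * (1 + tau * (8 + 5 * M)) + 1 + M.
have C0 : 0 < C.
  rewrite addr_gt0 // addr_gt0 // mulr_gt0 // ltr_pwDl // mulr_ge0 //.
  by rewrite addr_ge0 // mulr_ge0 // ltW.
have eLM0 : 0 < e / 4 / (L + M) by rewrite !divr_gt0 // addr_gt0.
have eC0 : 0 < e / 4 / C by rewrite !divr_gt0.
have [[z w] [zw /= zx]] := generator_dense x eLM0.
have [s0 s00 hs0] := chernoff_on_generator tau0 M0 eC0 hM zw.
(* From this index on t/n <= s0 for every t in [0, tau], whence the uniformity. *)
exists (Num.truncn (tau / s0)).+1 => // n /= Nn; apply: EP => t /=.
rewrite in_itv /= => /andP[t0 tt]; apply: eE => /=.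
rewrite -ball_normE /= distrC.
have n0 : (0 < n)%N by exact: leq_trans Nn.
have nR0 : 0 < n%:R :> R by rewrite ltr0n.
(* Time 0 is separate: the estimates require a positive step. *)
move: t0; rewrite le_eqVlt => /predU1P[<-|t0].
  have it0 : iter n (F 0) x = x by rewrite F0; elim: n {Nn n0 nR0} => //= n ->.
  by rewrite mul0r it0 T0 subrr normr0.
set s := t / n%:R.
have s_gt0 : 0 < s by rewrite divr_gt0.
have ns : n%:R * s = t by rewrite mulrC divfK ?gt_eqF.
have ss0 : s <= s0.
  rewrite ler_pdivrMr // mulrC -ler_pdivrMr //.
  apply: (@le_trans _ _ (tau / s0)); first by rewrite ler_pM2r // invr_gt0.
  have /andP[_ /ltW/le_trans] := truncn_itv (divr_ge0 tau0 (ltW s00)); apply.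
  by rewrite ler_nat.
(* Stability with the exact orbit of [z] as reference, hence with zero defect. *)
have H1 : `|iter n (F s) x - iter n (F s) z| <= L * `|z - x|.
  have := @iter_stability _ _ (F s) (fun k => iter k (F s) z) (a * s) 0 x n
    (lF (ltW s_gt0)) (bF (ltW s_gt0)).
  rewrite mulr_ge0 ?(ltW s_gt0) // lexx mulr0 addr0 mulrCA ns => /(_ isT isT).
  have step j : (j < n)%N -> `|F s (iter j (F s) z) - iter j.+1 (F s) z| <= 0.
    by rewrite subrr normr0.
  move=> /(_ step)/le_trans; apply; rewrite distrC ler_wpM2r //.
  by rewrite ler_expR ler_wpM2l.
have H2 : `|iter n (F s) z - T t z| <= C * (e / 4 / C).
  by have := hs0 s n; rewrite s_gt0 ss0 ns tt => /(_ isT isT).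
have H3 : `|T t z - T t x| <= M * `|z - x|.
  rewrite -(linear_funB (lT (ltW t0))); apply: hM.
  by rewrite (ltW t0) /= (le_trans tt) // lerDl.
have -> : iter n (F s) x - T t x = (iter n (F s) x - iter n (F s) z) +
    ((iter n (F s) z - T t z) + (T t z - T t x)).
  by rewrite [_ - T t z + _]addrA subrK addrA subrK.
apply: (le_lt_trans (ler_normD _ _)).
apply: (le_lt_trans (lerD H1 (le_trans (ler_normD _ _) (lerD H2 H3)))).
have : (L + M) * `|z - x| <= (L + M) * (e / 4 / (L + M)).
  by rewrite ler_pM2l // addr_gt0.
rewrite [_ * (e / 4 / _)]mulrC divfK ?gt_eqF ?addr_gt0 //.
rewrite [C * _]mulrC divfK ?gt_eqF // mulrDl; lra.
Qed.

End Chernoff.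

End Semigroups.

(** * Transfer to the original scalars *)

Section Transfer.
Context (R : realType) (K : numFieldType) (iota : {rmorphism R -> K}).
Hypothesis hK : real_scalars iota.
Context (X : normedModType K).
Local Notation Y := (restrict_scalars X hK).
Local Notation idR := (idfun : {rmorphism R -> R}).

Lemma linear_restrict_scalars (f : X -> X) :
  linear f -> linear (f : Y -> Y).
Proof. by move=> lf c u v; rewrite !iota_scaleE lf. Qed.

Lemma opnorm_le_restrict_scalars (f : X -> X) c :
  opnorm_le iota f c <-> forall x : Y, `|f x : Y| <= c * `|x|.
Proof.
by split=> h x; have := h x; rewrite -(iota_le hK) rmorphM !iota_normE.
Qed.

(** The difference quotients are the same functions, as [iota] commutes with inversion, and the two
    topologies are convertible. *)
Lemma generator_restrict_scalars (T : R -> X -> X) :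
  generator idR (T : R -> Y -> Y) = generator iota T.
Proof.
apply/funext => -[x w].
have E : (fun t => t^-1 *: (T t x - x : Y)) =
    (fun t => (iota t)^-1 *: (T t x - x)) :> (R -> X).
  by apply/funext => t; rewrite iota_scaleE fmorphV.
exact: (congr1 (fun f : R -> X => f t @[t --> 0^'+] --> w) E).
Qed.

Lemma deriv0_restrict_scalars (F : R -> X -> X) :
  Defs.deriv0 idR (F : R -> Y -> Y) = Defs.deriv0 iota F.
Proof.
apply/funext => -[x w].
have E : (fun t => t^-1 *: (F t x - F 0 x : Y)) =
    (fun t => (iota t)^-1 *: (F t x - F 0 x)) :> (R -> X).
  by apply/funext => t; rewrite iota_scaleE fmorphV.
exact: (congr1 (fun f : R -> X => f t @[t --> 0^'+] --> w) E).
Qed.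

Lemma C0_semigroup_restrict_scalars (T : R -> X -> X) :
  C0_semigroup iota T -> C0_semigroup idR (T : R -> Y -> Y).
Proof.
case=> bT T0 TD cT; split=> // t t0; have [lT [c hc]] := bT t t0.
split; first exact: linear_restrict_scalars.
by exists c; exact/opnorm_le_restrict_scalars.
Qed.
End Transfer.

(** * Chernoff equivalence of the product and the Feynman formula *)

Theorem theorem5p1 (R : realType) (K : numFieldType)
    (iota : {rmorphism R -> K}) (hK : real_scalars iota)
    (X : completeNormedModType K) (m : nat) (hm : (0 < m)%N)
    (Tk : 'I_m -> R -> X -> X)
    (hTk : forall k, C0_semigroup iota (Tk k))
    (T : R -> X -> X) (hT : C0_semigroup iota T)
    (hAclosable : closable (op_sum (fun k => generator iota (Tk k))))
    (hAgen : closure (op_sum (fun k => generator iota (Tk k)))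
             = generator iota T)
    (F : 'I_m -> R -> X -> X)
    (hFlin : forall k t, 0 <= t -> bounded_linear iota (F k t))
    (hFcont : forall k, strongly_continuous (F k))
    (hF0 : forall k, F k 0 = id)
    (hFbound : forall k, exists2 a : R, 0 < a &
       forall t, 0 <= t -> opnorm_le iota (F k t) (expR (a * t)))
    (Dk : 'I_m -> set X)
    (hDk : forall k, core (generator iota (Tk k)) (Dk k))
    (hFlim : forall k phi psi, Dk k phi -> generator iota (Tk k) (phi, psi) ->
       `|(iota t)^-1 *: (F k t phi - phi) - psi| @[t --> 0^'+] --> (0 : K))
    (D : set X) (hDsub : forall k, D `<=` Dk k)
    (hD : core (op_sum (fun k => generator iota (Tk k))) D) :
  let Ft := fun t : R => \big[comp/id]_(k < m) F k t in
  chernoff_equivalent iota Ft T /\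
  forall (x : X) (tau : R), 0 <= tau ->
    {uniform `[0, tau]%classic,
       (fun n t => iter n (Ft (t / n%:R)) x) @ \oo --> (fun t => T t x)}.
Proof.
move=> Ft; have [subD domD closD] := hD.
have [a ha] : exists a : 'I_m -> R, forall k, 0 < a k /\
    forall t, 0 <= t -> opnorm_le iota (F k t) (expR (a k * t)).
  have ex k : exists b : R, 0 < b /\
      forall t, 0 <= t -> opnorm_le iota (F k t) (expR (b * t)).
    by have [b b0 hb] := hFbound k; exists b.
  by have [f hf] := boolp.choice ex; exists f.
pose Y : completeNormedModType R := restrict_scalars X hK.
pose FY : 'I_m -> R -> Y -> Y := F.
have lFY k t : 0 <= t -> linear (FY k t).
  by move=> t0; apply: linear_restrict_scalars; case: (hFlin k t t0).
have bFY k t : 0 <= t -> forall x, `|FY k t x| <= expR (a k * t) * `|x|.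
  by move=> t0; apply/opnorm_le_restrict_scalars; case: (ha k) => _; apply.
have cFY k : strongly_continuous (FY k) by exact: hFcont.
have F0Y k : FY k 0 = id by exact: hF0.
pose b := \sum_(k < m) a k.
have b0 : 0 <= b by apply: sumr_ge0 => k _; rewrite ltW //; case: (ha k).
have linFt t : 0 <= t -> linear (Ft t).
  move=> t0; rewrite /Ft; apply: (big_ind (fun f : X -> X => linear f)) => //.
    exact: linear_comp_fun.
  by move=> k _; case: (hFlin k t t0).
have opFt t : 0 <= t -> opnorm_le iota (Ft t) (expR (b * t)).
  by move=> t0; apply/opnorm_le_restrict_scalars => x; exact: norm_bigcomp.
have Ft0 : Ft 0 = id by exact: (bigcomp0 F0Y).
have derFt x y : D x -> op_sum (fun k => generator iota (Tk k)) (x, y) ->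
    Defs.deriv0 iota Ft (x, y).
  move=> Dx [yk hyk /= ->].
  rewrite -(deriv0_restrict_scalars hK) /Defs.deriv0 /= Ft0.
  apply: (deriv0_bigcomp lFY bFY cFY F0Y) => k.
  have /norm_cvg0 := hFlim k x (yk k) (hDsub k x Dx) (hyk k).
  move=> /subr_cvg0.
  by under eq_fun do rewrite -fmorphV.
(* On [D] the sum of the generators is defined and contained in F'(0); uniqueness of limits gives
   equality. *)
have coreE : op_restrict (Defs.deriv0 iota Ft) D =
    op_restrict (op_sum (fun k => generator iota (Tk k))) D.
  apply/seteqP; split=> -[x y] [/= xy Dx]; split => //=; last exact: derFt.
  have [z xz] := domD x Dx; suff -> : y = z by [].
  exact: (cvg_unique (norm_hausdorff (V := X)) xy (derFt _ _ Dx xz)).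
split.
  split => //.
  - by move=> t t0; split; [exact: linFt|exists (expR (b * t)); exact: opFt].
  - exact: (strongly_continuous_bigcomp lFY bFY cFY).
  - by exists b.
  - exists D; split => //.
    + by move=> x Dx; have [y xy] := domD x Dx; exists y; exact: derFt.
    + by rewrite coreE => x y z; rewrite closD; exact: hAclosable.
    + by rewrite coreE closD.
move=> x tau tau0.
have hTY := C0_semigroup_restrict_scalars hK hT.
apply: (@chernoff_uniform R Y T hTY Ft b) => //.
- by move=> t t0; apply: linear_restrict_scalars; exact: linFt.
- by move=> t t0; apply/opnorm_le_restrict_scalars; exact: opFt.
(* The generator is the closure of A, hence of A on [D], hence of F'(0) on [D], which lies in the
   closure of F'(0). *)
- rewrite generator_restrict_scalars deriv0_restrict_scalars.
  by rewrite -hAgen -closD -coreE; apply: closureS => p [].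
Qed.
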